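(* Let $G=(V,E,\omega,\mu)$ be a finite connected weighted graph, let $p>1$, and let $\psi:V\to[0,\infty)$ be not identically zero. For $\lambda>0$ let $T_\lambda$ be the life span of the solution of $u_t=\Delta u+u^p$ on $V$ with $u(x,0)=\lambda\psi(x)$. Then: (1) There exists $\Lambda=\Lambda(p,\psi,G)>0$ such that if $\lambda>\Lambda$, then $T_\lambda<\infty$. Moreover, $\displaystyle\lim_{\lambda\to\infty}\lambda^{p-1}T_\lambda=\frac1{(p-1)(\max_V\psi)^{p-1}}$. (2) If $\min_V\psi>0$, then $T_\lambda<\infty$ for every $\lambda>0$. (3) If $\min_V\psi>0$, then $$\frac1{(p-1)(\max_V\psi)^{p-1}}\le\liminf_{\lambda\to0}\lambda^{p-1}T_\lambda\le\limsup_{\lambda\to0}\lambda^{p-1}T_\lambda\le\frac1{(p-1)(\min_V\psi)^{p-1}}.$$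
   Context: Weighted graph: $V$ is the (finite) vertex set, $E$ the edge set, $y\sim x$ means $xy\in E$; $\omega:V\times V\to[0,\infty)$ satisfies $\omega_{xy}=\omega_{yx}$ and $\omega_{xy}>0$ iff $x\sim y$; $\mu:V\to(0,\infty)$. Graphs have no loops and no multiple edges. The Laplacian is $\Delta u(x)=\frac1{\mu(x)}\sum_{y\sim x}\omega_{xy}(u(y)-u(x))$. Solution: a solution in $[0,T)$ of the problem $u_t=\Delta u+u^p$ in $V\times(0,T)$, $u(x,0)=\lambda\psi(x)$ on $V$, is a function $u:V\times[0,T)\to[0,\infty)$ satisfying the problem such that for each $x\in V$ the function $u(x,\cdot)$ is continuous on $[0,T)$ and $C^1$ on $(0,T)$, and such that $u$ is bounded on $V\times[0,T']$ for every $0<T'<T$. (A unique local solution exists.) The life span is $T_\lambda=\sup\{T>0:\ \text{the problem has a solution in }[0,T)\}\in(0,\infty]$. *)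

(* Defs.v *)
From HB Require Import structures.
From mathcomp Require Import all_boot all_order all_algebra.
From mathcomp Require Import all_classical all_reals all_analysis.

Set Implicit Arguments.
Unset Strict Implicit.
Unset Printing Implicit Defensive.

Import Order.TTheory GRing.Theory Num.Theory.
Import numFieldNormedType.Exports.

Local Open Scope classical_set_scope.
Local Open Scope ring_scope.

Record weighted_graph (R : realType) (V : finType) := WeightedGraph {
  adj : rel V;
  weight : V -> V -> R;
  vmeas : V -> R;
  adj_sym : symmetric adj;
  adj_irr : irreflexive adj;
  weight_ge0 : forall x y : V, 0 <= weight x y;
  weight_sym : forall x y, weight x y = weight y x;
  weight_gt0 : forall x y, (0 < weight x y) = adj x y;
  vmeas_gt0 : forall x, 0 < vmeas x
}.

Section Problem.
Variables (R : realType) (V : finType).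
Implicit Types (G : weighted_graph R V) (f phi : V -> R) (u : V -> R -> R).

Definition connected_graph G : Prop := forall x y : V, connect (adj G) x y.

Definition laplacian G f (x : V) : R :=
  (vmeas G x)^-1 * \sum_(y | adj G x y) weight G x y * (f y - f x).

(* The problem u_t = Delta u + u^p in V x (0,T), u(.,0) = phi.  A solution is
   represented by a function of a real time variable of which only the
   restriction to [0,T) matters. *)
Definition is_solution G (p : R) phi (T : R) u : Prop :=
  [/\ forall x (t : R), 0 <= t < T -> 0 <= u x t,
      forall x, {within `[0, T[, continuous (u x)},
      forall x (t : R), 0 < t < T ->
        derivable (u x) t 1 /\ {for t, continuous (derive1 (u x))},
      forall T' : R, 0 < T' < T ->
        exists M : R, forall x (t : R), 0 <= t <= T' -> `|u x t| <= M &
      (forall x (t : R), 0 < t < T ->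
        derive1 (u x) t = laplacian G (fun y => u y t) x + u x t `^ p) /\
      (forall x, u x 0 = phi x)].

Definition life_span G (p : R) phi : \bar R :=
  ereal_sup
    [set T%:E | T in [set T : R | 0 < T /\ exists u, is_solution G p phi T u]].

(* The value 0 is only taken when V is empty. *)
Definition vmax f : R :=
  if [pick x : V] is Some x0 then \big[Num.max/f x0]_(x : V) f x else 0.

Definition vmin f : R :=
  if [pick x : V] is Some x0 then \big[Num.min/f x0]_(x : V) f x else 0.

End Problem.

(* Main.v *)
(* Lower bound on the life span: the solution z of z' = z^p started at
   lambda * max psi is a spatially constant supersolution, which explodes at
   time 1 / ((p - 1) (lambda max psi)^(p-1)).  Put v = e^{Dt} u with D at least
   every weighted degree; then the equation for v is cooperative, so Picard
   iteration from 0 increases and stays below e^{Dt} z, and its limit solves the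
   problem as long as z exists.
   Upper bounds: at a vertex where u is minimal the Laplacian is nonnegative, so
   u dominates the solution of y' = y^p started at lambda * min psi.  At a
   maximum point of psi, nonnegativity of u gives u' >= u^p - d u with d the
   weighted degree; for large lambda the term d u is a perturbation of relative
   size d / (lambda max psi)^(p-1), which tends to 0. *)

Require Import Defs.
From HB Require Import structures.
From mathcomp Require Import all_boot all_order all_algebra.
From mathcomp Require Import all_classical all_reals all_analysis.
From mathcomp Require Import measurable_realfun.
From mathcomp Require Import ring lra.

Import Order.TTheory GRing.Theory Num.Theory.
Import numFieldNormedType.Exports.

Local Open Scope classical_set_scope.
Local Open Scope ring_scope.

(** * First crossing times for finite families of functions *)

Lemma derive1_gt0_left (R : realType) (f : R -> R) (t : R) :
  derivable f t 1 -> 0 < derive1 f t -> \forall s \near t^'-, f s < f t.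
Proof.
move=> df; rewrite derive1E => f'_gt0.
have /cvgr_gt/(_ _ f'_gt0) :
  (h^-1 *: (f (h *: 1 + t) - f t)) @[h --> 0^'] --> 'D_1 f t by [].
move=> /= [e /= e0 He]; exists e => //= s /= ste st.
have := He (s - t); rewrite /= sub0r normrN distrC => /(_ ste).
rewrite subr_eq0 lt_eqF// => /(_ isT).
rewrite [_%:A]mulr1 subrK => H.
have {}H : 0 < (s - t)^-1 * (f s - f t) by [].
by move: H; rewrite nmulr_rgt0 ?invr_lt0 ?subr_lt0.
Qed.

(** Let [t0] be the infimum of the times at which some component is nonpositive. At [t0] no
    component is negative and one of them vanishes. Its derivative there is positive, so it is
    negative just before [t0], which contradicts the choice of [t0]. *)
Lemma first_crossing (R : realType) (I : finType) (f : I -> R -> R) (T : R) :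
  (forall i, {within `[0, T[, continuous (f i)}) ->
  (forall i t, 0 < t < T -> derivable (f i) t 1) ->
  (forall i, 0 < f i 0) ->
  (forall i t, 0 < t < T -> f i t = 0 -> (forall j, 0 <= f j t) ->
    0 < derive1 (f i) t) ->
  forall i t, 0 <= t < T -> 0 < f i t.
Proof.
move=> fc df f0 f' i1 t1 /andP[t1_ge0 t1T]; rewrite ltNge; apply/negP => f1.
pose A := [set t | 0 <= t <= t1 /\ exists i, f i t <= 0].
have At1 : A t1 by split; [rewrite t1_ge0 lexx|exists i1].
have lbA : lbound A 0 by move=> t [/andP[]].
have infA : has_inf A by split; [exists t1|exists 0].
pose t0 := inf A.
have t0_ge0 : 0 <= t0 by apply: lb_le_inf => //; exists t1.
have t0t1 : t0 <= t1 by apply: ge_inf => //; exists 0.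
have t0T : t0 < T by exact: le_lt_trans t0t1 t1T.
have before i s : 0 <= s < t0 -> 0 < f i s.
  move=> /andP[s0 st0]; rewrite ltNge; apply/negP => fs.
  have : A s by split; [rewrite s0 (le_trans (ltW st0))|exists i].
  by move=> /ge_inf => /(_ (ex_intro _ 0 lbA)); rewrite leNgt st0.
have cf i : f i @ within `[0, T[ (nbhs t0) --> f i t0.
  by have /subspace_continuousP := fc i; apply; rewrite /= in_itv/= t0_ge0.
(* The infimum is attained: otherwise all components are positive at [t0], and since [I] is finite,
   continuity keeps them positive on a common interval to the right, where the infimum has to be
   approached. *)
have [i fi] : exists i, f i t0 <= 0.
  apply: contrapT => /forallNP nf.
  have : \forall s \near t0, forall i, s \in `[0, T[ -> 0 < f i s.
    apply: (@filter_forall _ I (fun i s => s \in `[0, T[ -> 0 < f i s) _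
      (nbhs_filter t0)) => i.
    have := nf i => /negP; rewrite -ltNge => fi.
    exact: cvgr_gt _ (cf i) _ fi.
  move=> [e /= e0 He].
  have [s [/andP[s0 st1] [j fj]] se] := inf_adherent e0 infA.
  have ts : t0 <= s by apply: ge_inf; [exists 0|split; [rewrite s0 st1|exists j]].
  have := He s; rewrite /= ler0_norm ?subr_le0// opprB ltrBlDl => /(_ se j).
  by rewrite in_itv/= s0 (le_lt_trans st1 t1T) => /(_ isT); rewrite ltNge fj.
have t0_gt0 : 0 < t0.
  rewrite lt_neqAle t0_ge0 andbT; apply/eqP => t00.
  by move: fi; rewrite leNgt -t00 f0.
have near_left (P : set R) : (\forall s \near t0^'-, P s) ->
    exists2 s, 0 <= s < t0 & P s.
  move=> Pn.
  have : \forall s \near t0^'-, 0 <= s < t0 /\ P s.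
    near=> s; split; last by near: s.
    apply/andP; split; last by near: s; exact: nbhs_left_lt.
    by apply/ltW; near: s; exact: nbhs_left_gt.
  by move=> /filter_ex[s []]; exists s.
have f_ge0 j : 0 <= f j t0.
  rewrite leNgt; apply/negP => fj.
  have [s st0 /ltW] : exists2 s, 0 <= s < t0 & f j s < 0.
    apply: near_left.
    have : \forall s \near t0^'-, s \in `[0, T[ -> f j s < 0.
      apply: cvg_within; exact: cvgr_lt _ (cf j) _ fj.
    move=> H; near=> s; apply: (near H) => //.
    rewrite in_itv/=; apply/andP; split.
      by apply/ltW; near: s; exact: nbhs_left_gt.
    by apply: (@lt_trans _ _ t0) => //; near: s; exact: nbhs_left_lt.
  by rewrite leNgt before.
have fi0 : f i t0 = 0 by apply/eqP; rewrite eq_le fi f_ge0.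
have t0i : 0 < t0 < T by rewrite t0_gt0.
have [s st0] :=
  near_left _ (derive1_gt0_left _ _ _ (df i _ t0i) (f' i _ t0i fi0 f_ge0)).
by rewrite fi0 ltNge ltW// before.
Unshelve. all: by end_near. Qed.

(** * The equation y' = c y^p and upper bounds on blow-up times *)

Definition bernoulli {R : realType} (p c q t : R) : R :=
  (q - (p - 1) * c * t) `^ (- (p - 1)^-1).

(** With r = 1 / (p - 1) one has - r - 1 = - r p, so differentiating the power reproduces the p-th
    power. The parameter [q] is the initial value raised to 1 - p; this makes the base affine in
    time, and the explosion is its zero. *)
Lemma is_derive_bernoulli (R : realType) (p c q t : R) :
  1 < p -> 0 < q - (p - 1) * c * t ->
  is_derive t 1 (bernoulli p c q) (c * bernoulli p c q t `^ p).
Proof.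
move=> p1 qt.
have p10 : p - 1 != 0 by rewrite subr_eq0 gt_eqF.
have := is_derive1_powR (- (p - 1)^-1) qt => dp.
have dl : is_derive t 1 (fun t => q - (p - 1) * c * t) (- ((p - 1) * c)).
  by apply: is_derive_eq; rewrite /= add0r mul1r [_%:A]mulr1.
have := @is_derive1_comp _ (fun x => x `^ (- (p - 1)^-1))
  (fun t => q - (p - 1) * c * t) _ _ _ dp dl.
move=> /is_derive_eq; apply.
rewrite /bernoulli -powRrM.
have -> : - (p - 1)^-1 * p = - (p - 1)^-1 - 1 by field; rewrite p10.
by field; rewrite p10.
Qed.

Lemma bernoulli_gt0 (R : realType) (p c q t : R) :
  0 < q - (p - 1) * c * t -> 0 < bernoulli p c q t.
Proof. exact: powR_gt0. Qed.

Lemma le_powRN (R : realType) (s x y : R) :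
  0 <= s -> 0 < x -> x <= y -> y `^ (- s) <= x `^ (- s).
Proof.
move=> s0 x0 xy; have y0 := lt_le_trans x0 xy.
rewrite !powRN lef_pV2 ?posrE ?powR_gt0//.
by apply: ge0_ler_powR => //; rewrite nnegrE ltW.
Qed.

Lemma lt_powRN (R : realType) (s x y : R) :
  0 < s -> 0 < x -> x < y -> y `^ (- s) < x `^ (- s).
Proof.
move=> s0 x0 xy; have y0 := lt_trans x0 xy.
rewrite !powRN ltf_pV2 ?posrE ?powR_gt0//.
by apply: gt0_ltr_powR => //; rewrite nnegrE ltW.
Qed.

Lemma powRN_powRV (R : realType) (s x : R) :
  0 <= x -> s != 0 -> (x `^ (- s)) `^ (- s^-1) = x.
Proof. by move=> x0 s0; rewrite -powRrM mulrNN divff// powRr1. Qed.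

(* Comparison with [bernoulli p c q], which explodes at time q / ((p - 1) c). *)
Lemma strict_blowup_time (R : realType) (I : finType) (i0 : I) (f : I -> R -> R)
    (p c q T : R) :
  1 < p -> 0 < c -> 0 < q ->
  (forall i, {within `[0, T[, continuous (f i)}) ->
  (forall i t, 0 < t < T -> derivable (f i) t 1) ->
  (forall T', 0 < T' < T -> exists M, forall t, 0 <= t <= T' -> f i0 t <= M) ->
  (forall i, q `^ (- (p - 1)^-1) < f i 0) ->
  (forall i t, 0 < t < T -> q `^ (- (p - 1)^-1) <= f i t ->
    (forall j, f i t <= f j t) -> c * f i t `^ p < derive1 (f i) t) ->
  T <= q / ((p - 1) * c).
Proof.
move=> p1 c0 q0 fc df fb f0 f'; rewrite leNgt; apply/negP.
set T0 := q / _ => T0T.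
have p10 : 0 < p - 1 by rewrite subr_gt0.
have r0 : 0 < (p - 1)^-1 by rewrite invr_gt0.
have T00 : 0 < T0 by rewrite divr_gt0// mulr_gt0.
have arg_gt0 t : t < T0 -> 0 < q - (p - 1) * c * t.
  by rewrite /T0 ltr_pdivlMr ?mulr_gt0// subr_gt0 mulrC.
have subT t : t < T0 -> t < T by move=> /lt_trans; exact.
have gt0 i t : 0 <= t < T0 -> 0 < f i t - bernoulli p c q t.
  apply: (first_crossing _ _ (fun i t => f i t - bernoulli p c q t)) => {i t}.
  - move=> i x; apply: continuousB.
      apply: (continuous_subspaceW _ (fc i)) => y /=; rewrite !in_itv/= => /andP[-> /=].
      exact: subT.
    apply: derivable_within_continuous => y; rewrite in_itv/= => /andP[_ yT].
    by have [] := is_derive_bernoulli _ p c q y p1 (arg_gt0 _ yT).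
  - move=> i t /andP[t0 tT]; apply: derivableB.
      by apply: df; rewrite t0 subT.
    by have [] := is_derive_bernoulli _ p c q t p1 (arg_gt0 _ tT).
  - by move=> i; rewrite subr_gt0 /bernoulli mulr0 subr0.
  (* All components are compared with the same barrier. One that touches it is therefore the
     smallest, and it is at least the initial value of the barrier, since the barrier increases.
     These are the two conditions under which the differential inequality is assumed. *)
  - move=> i t /andP[t0 tT] /eqP; rewrite subr_eq0 => /eqP fit fj.
    have dy := is_derive_bernoulli _ p c q t p1 (arg_gt0 _ tT).
    have dfi : derivable (f i) t 1 by apply: df; rewrite t0 subT.
    have dby := @ex_derive _ _ _ _ _ _ _ dy.
    rewrite derive1E deriveB//.
    rewrite (@derive_val _ _ _ _ _ _ _ dy) -fit subr_gt0 -derive1E.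
    apply: f'; first by rewrite t0 subT.
      rewrite fit; apply: le_powRN; [exact: ltW|exact: arg_gt0|].
      by rewrite gerBl mulr_ge0 ?ltW// mulr_gt0.
    by move=> j; have := fj j; rewrite subr_ge0 -fit.
have [|M HM] := fb T0; first by rewrite T00.
pose K := Num.max M 0 + 1.
have K0 : 0 < K by rewrite /K ltr_wpDl// le_max lexx orbT.
(* [e] is the base of the barrier at the time [t] chosen below. The bound [q / 2] makes [t]
   nonnegative; the other bound lifts the barrier to at least [K], hence above the bound [M] for
   [f i0] on the whole of [[0, T0]]. *)
pose e := Num.min (q / 2) (K `^ (- (p - 1))).
have e0 : 0 < e by rewrite lt_min divr_gt0//= powR_gt0.
have eq : e < q by rewrite gt_min ltr_pdivrMr// ltr_pMr// ltr1n.
pose t := (q - e) / ((p - 1) * c).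
have tT : t < T0 by rewrite /t /T0 ltr_pM2r ?invr_gt0 ?mulr_gt0// gtrBl.
have t0 : 0 <= t by rewrite ltW// divr_gt0 ?subr_gt0 ?mulr_gt0.
have := gt0 i0 t; rewrite t0 tT => /(_ isT).
apply/negP; rewrite -leNgt subr_le0.
have -> : bernoulli p c q t = e `^ (- (p - 1)^-1).
  by congr (_ `^ _); rewrite /t; field; rewrite !gt_eqF.
apply: le_trans (HM t _) _; first by rewrite t0 ltW.
apply: (@le_trans _ _ K); first by rewrite /K ler_wpDr// le_max lexx.
have p1n0 : p - 1 != 0 by rewrite gt_eqF.
rewrite -[leLHS](powRN_powRV _ _ K (ltW K0) p1n0).
by apply: le_powRN; [exact: ltW|exact: e0|rewrite ge_min lexx orbT].
Qed.

(** Above the level q^(-1/(p-1)) one has f <= q f^p, so f^p - d f >= (1 - d q) f^p and the linear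
    loss only lowers the rate. The strict version is applied to slightly perturbed data, and the
    perturbation is then made small. The family is later either a single function or all vertices at
    once. *)
Lemma blowup_time (R : realType) (I : finType) (i0 : I) (f : I -> R -> R)
    (p d m T : R) :
  1 < p -> 0 <= d -> 0 < m -> d * (m `^ (p - 1))^-1 < 1 ->
  (forall i, {within `[0, T[, continuous (f i)}) ->
  (forall i t, 0 < t < T -> derivable (f i) t 1) ->
  (forall T', 0 < T' < T -> exists M, forall t, 0 <= t <= T' -> f i0 t <= M) ->
  (forall i, m <= f i 0) ->
  (forall i t, 0 < t < T -> (forall j, f i t <= f j t) ->
    f i t `^ p - d * f i t <= derive1 (f i) t) ->
  T <= (m `^ (p - 1))^-1 / ((p - 1) * (1 - d * (m `^ (p - 1))^-1)).
Proof.
move=> p1 d0 m0; set Q := _^-1 => dQ1 fc df fb f0 f'.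
have p10 : 0 < p - 1 by rewrite subr_gt0.
have r0 : 0 < (p - 1)^-1 by rewrite invr_gt0.
have Q0 : 0 < Q by rewrite invr_gt0 powR_gt0.
have QE : Q `^ (- (p - 1)^-1) = m.
  by rewrite /Q -powRN powRN_powRV ?ltW// gt_eqF.
have dQ0 : 0 <= d * Q by rewrite mulr_ge0// ltW.
(* Enlarging [Q] to [q] makes the initial comparison strict; subtracting [e] from the rate makes the
   differential one strict. The condition on [e] says that the rate [c] stays positive. *)
have perturbed e : 0 < e -> e * (d * Q + 1) < 1 - d * Q ->
    T * ((p - 1) * (1 - d * (Q * (1 + e)) - e)) <= Q * (1 + e).
  move=> e0 ec; set q := Q * (1 + e); set c := _ - e.
  have c0 : 0 < c by rewrite /c /q; lra.
  have Qq : Q < q by rewrite /q ltr_pMr// ltrDl.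
  have q0 : 0 < q by exact: lt_trans Qq.
  rewrite -ler_pdivlMr ?mulr_gt0//.
  apply: (strict_blowup_time _ _ i0 f) => // [i|i t tT fq fj].
    by apply: lt_le_trans (f0 i); rewrite -QE lt_powRN.
  apply: lt_le_trans (f' _ _ tT fj).
  have ft0 : 0 < f i t by apply: lt_le_trans fq; exact: powR_gt0.
  have fp0 : 0 < f i t `^ p by exact: powR_gt0.
  have : f i t <= q * f i t `^ p.
    have : q^-1 <= f i t `^ (p - 1).
      have -> : q^-1 = (q `^ (- (p - 1)^-1)) `^ (p - 1).
        by rewrite -powRrM mulNr mulVf ?gt_eqF// powR_inv1// ltW.
      by apply: ge0_ler_powR; rewrite ?nnegrE ?powR_ge0// ltW.
    rewrite -(mulr_powRB1 (ltW ft0) (lt_trans ltr01 p1)).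
    by rewrite mulrCA ler_pMr// -ler_pdivrMl// mulr1.
  move=> /(ler_wpM2l d0) H; rewrite /c; nra.
rewrite ler_pdivlMr; last by rewrite mulr_gt0// subr_gt0.
rewrite leNgt; apply/negP => QX.
have T0 : 0 < T.
  rewrite -(@pmulr_lgt0 _ ((p - 1) * (1 - d * Q))); first exact: lt_trans QX.
  by rewrite mulr_gt0// subr_gt0.
set X := T * _ in QX.
(* With this [K] the conclusion of [perturbed] reads [X - Q <= e * K]. The first bound on [e]
   contradicts it; the second makes [perturbed] applicable. *)
pose K := Q + T * (p - 1) * (d * Q + 1).
have K0 : 0 < K by rewrite addr_gt0// !mulr_gt0// ltr_wpDl.
have dQ10 : 0 < d * Q + 1 by rewrite ltr_wpDl.
pose e := Num.min ((X - Q) / (2 * K)) ((1 - d * Q) / (2 * (d * Q + 1))).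
have e0 : 0 < e by rewrite lt_min !divr_gt0 ?mulr_gt0 ?subr_gt0.
have eK : e * (2 * K) <= X - Q.
  by rewrite -ler_pdivlMr ?mulr_gt0// ge_min lexx.
have ed : e * (2 * (d * Q + 1)) <= 1 - d * Q.
  by rewrite -ler_pdivlMr ?mulr_gt0// ge_min lexx orbT.
have ed0 : 0 < e * (d * Q + 1) by rewrite mulr_gt0.
have eK0 : 0 < e * K by rewrite mulr_gt0.
have := perturbed e e0; have -> : e * (d * Q + 1) < 1 - d * Q by lra.
move=> /(_ isT).
have -> : T * ((p - 1) * (1 - d * (Q * (1 + e)) - e)) = X - e * K + e * Q.
  by rewrite /X /K; ring.
by lra.
Qed.

(** * Continuity of the power and comparison through derivatives *)

Lemma continuous_powR_norm (R : realType) (p : R) :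
  1 < p -> continuous (fun w : R => `|w| `^ p).
Proof.
move=> p1 w; have [->|w0] := eqVneq w 0.
  rewrite /continuous_at normr0 powR0; last by rewrite gt_eqF// (lt_trans ltr01).
  (* Near 0 the base is at most 1 and p > 1, so the power lies between 0 and the base. *)
  apply: (@squeeze_cvgr _ _ _ _ (fun=> 0) (fun w : R => `|w|)).
  - near=> x; rewrite powR_ge0/=.
    have [->|x0] := eqVneq x 0.
      by rewrite normr0 powR0// gt_eqF// (lt_trans ltr01).
    apply: ge1r_powR; last exact: ltW.
    rewrite normr_gt0 x0/=; near: x; exists 1 => //= x /=.
    by rewrite sub0r normrN => /ltW.
  - exact: cvg_cst.
  - by have := @norm_continuous R R 0; rewrite /continuous_at normr0.
apply: (@continuous_comp _ _ _ (fun w : R => `|w|) (fun x => x `^ p)).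
  exact: norm_continuous.
apply/differentiable_continuous/derivable1_diffP.
by apply: derivable_powR; rewrite in_itv/= andbT normr_gt0.
Unshelve. all: by end_near. Qed.

Lemma derivable_cstD (R : realType) (c : R) (f : R -> R) (t : R) :
  derivable f t 1 ->
  derivable (fun s => c + f s) t 1 /\ derive1 (fun s => c + f s) t = derive1 f t.
Proof.
move=> df; have dc : derivable (cst c) t 1 by exact: derivable_cst.
rewrite -[fun s => c + f s]/(cst c + f); split; first exact: derivableD.
by rewrite derive1E (deriveD dc df) derive_cst add0r -derive1E.
Qed.

Lemma derive1_le_monotone (R : realType) (f g : R -> R) (T : R) :
  {within `[0, T], continuous f} -> {within `[0, T], continuous g} ->
  (forall t, 0 < t < T -> derivable f t 1) ->
  (forall t, 0 < t < T -> derivable g t 1) ->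
  (forall t, 0 < t < T -> derive1 f t <= derive1 g t) ->
  f 0 <= g 0 -> forall t, 0 <= t <= T -> f t <= g t.
Proof.
move=> fc gc df dg fg' fg0 t /andP[t0 tT].
have : (f - g) t <= (f - g) 0.
  apply: (@ler0_derive1_nincr _ (f - g) 0 T _ _ _ 0 t (lexx 0) t0 tT).
  - by move=> s; rewrite in_itv/= => sT; apply: derivableB; [exact: df|exact: dg].
  - move=> s; rewrite in_itv/= => sT; have dfs := df _ sT; have dgs := dg _ sT.
    by rewrite derive1E (deriveB dfs dgs) -!derive1E subr_le0; exact: fg'.
  - apply/subspace_continuousP => s sT.
    move/subspace_continuousP : fc => /(_ s sT) fs.
    move/subspace_continuousP : gc => /(_ s sT) gs.
    exact: cvgB fs gs.
rewrite -[(f - g) t]/(f t - g t) -[(f - g) 0]/(f 0 - g 0).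
by move: fg0; lra.
Qed.

(** * Picard iteration for a cooperative system below a supersolution *)

Section CooperativeSystem.
Variables (R : realType) (V : finType) (p : R) (a : V -> V -> R).
Hypotheses (p1 : 1 < p) (a_ge0 : forall x y, 0 <= a x y).

(* [`|w x|] instead of [w x] because [powR] is discontinuous at 0 from the left. *)
Definition growth (k : R) (w : V -> R) (x : V) : R :=
  \sum_y a x y * w y + k * `|w x| `^ p.

(** An arbitrary filter serves both continuity in time and the passage to the limit in the index of
    the iteration. *)
Lemma growth_cvg (I : Type) (F : set_system I) (k : I -> R) (w : V -> I -> R)
    (k0 : R) (w0 : V -> R) (x : V) : Filter F ->
  k i @[i --> F] --> k0 -> (forall y, w y i @[i --> F] --> w0 y) ->
  growth (k i) (w ^~ i) x @[i --> F] --> growth k0 w0 x.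
Proof.
move=> FF kk ww.
apply: (@cvgD _ R^o _ _ _ (fun i => \sum_y a x y * w y i)
  (fun i => k i * `|w x i| `^ p)).
  apply: (@cvg_big R^o _ _ _ _ (@add_continuous R^o) _ _ _
    (fun y i => a x y * w y i) (fun y => a x y * w0 y)) => y _.
  by apply: cvgM; [exact: cvg_cst|exact: ww].
apply: cvgM => //.
exact: (cvg_comp _ _ (ww x) (@continuous_powR_norm _ _ p1 (w0 x))).
Qed.

Lemma growth_ge0 (k : R) (w : V -> R) (x : V) :
  0 <= k -> (forall y, 0 <= w y) -> 0 <= growth k w x.
Proof.
move=> k0 w0; apply: addr_ge0; last by rewrite mulr_ge0 ?powR_ge0.
by apply: sumr_ge0 => y _; rewrite mulr_ge0.
Qed.

Lemma growth_mono (k : R) (w w' : V -> R) (x : V) :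
  0 <= k -> (forall y, 0 <= w y <= w' y) -> growth k w x <= growth k w' x.
Proof.
move=> k0 ww; have w0 y : 0 <= w y by have /andP[] := ww y.
have w'0 y : 0 <= w' y by have /andP[/le_trans] := ww y; exact.
apply: lerD.
  by apply: ler_sum => y _; rewrite ler_wpM2l//; have /andP[] := ww y.
apply: ler_wpM2l => //; rewrite !ger0_norm//.
apply: ge0_ler_powR; rewrite ?nnegrE//; first exact/ltW/(lt_trans ltr01).
by have /andP[] := ww x.
Qed.

Variables (T : R) (k Z : R -> R) (phi : V -> R).
Hypotheses (T0 : 0 < T) (kc : {within `[0, T], continuous k}).
Hypotheses (k_ge0 : forall t, 0 <= k t) (phi_ge0 : forall x, 0 <= phi x).

Lemma within_growth (w : V -> R -> R) (x : V) :
  (forall y, {within `[0, T], continuous (w y)}) ->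
  {within `[0, T], continuous (fun t => growth (k t) (w ^~ t) x)}.
Proof.
move=> wc; apply/subspace_continuousP => t t0T.
apply: growth_cvg => [|y]; first by move/subspace_continuousP : kc; exact.
by move/subspace_continuousP : (wc y); exact.
Qed.

Let mu := @lebesgue_measure R.

Definition primitive (c : R) (g : R -> R) (t : R) : R :=
  c + \int[mu]_(s in `[0, t]) g s.

Lemma primitive0 c g : primitive c g 0 = c.
Proof. by rewrite /primitive set_itv1 Rintegral_set1 addr0. Qed.

Lemma within_integrable (g : R -> R) :
  {within `[0, T], continuous g} -> mu.-integrable `[0, T] (EFin \o g).
Proof. by apply: continuous_compact_integrable; exact: segment_compact. Qed.

Lemma integrable_initial (g : R -> R) (t : R) :
  t <= T -> mu.-integrable `[0, T] (EFin \o g) -> mu.-integrable `[0, t] (EFin \o g).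
Proof.
move=> tT; apply: integrableS => // s /=; rewrite !in_itv/= => /andP[-> /=].
by move=> /le_trans; exact.
Qed.

Lemma within_primitive c (g : R -> R) :
  mu.-integrable `[0, T] (EFin \o g) -> {within `[0, T], continuous (primitive c g)}.
Proof.
move=> ig; apply/subspace_continuousP => t t0T.
have /subspace_continuousP/(_ t t0T) := parameterized_integral_continuous (ltW T0) ig.
by apply: cvgD; exact: cvg_cst.
Qed.

Lemma derive_primitive c (g : R -> R) (t : R) :
  {within `[0, T], continuous g} -> 0 < t < T ->
  derivable (primitive c g) t 1 /\ derive1 (primitive c g) t = g t.
Proof.
move=> gc /andP[t0 tT].
have gt : {for t, continuous g}.
  by apply: (within_continuous_continuous T0 gc); rewrite in_itv/= t0.
have [dF F'] := continuous_FTC1_closed tT (within_integrable _ gc) t0 gt.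
have [dc c'] := derivable_cstD _ c _ _ dF.
by split; [exact: dc|rewrite -F'; exact: c'].
Qed.

(** The iteration starts from 0 rather than from [phi], so that its first step is an increase merely
    because [phi] and [growth] are nonnegative. *)
Fixpoint picard (n : nat) (x : V) (t : R) : R :=
  if n is n'.+1
  then primitive (phi x) (fun s => growth (k s) (fun y => picard n' y s) x) t
  else 0.

Lemma within_picard n x : {within `[0, T], continuous (picard n x)}.
Proof.
elim: n x => [|n IH] x; first exact: cst_continuous.
exact/within_primitive/within_integrable/within_growth.
Qed.

Let step n x s := growth (k s) (fun y => picard n y s) x.

Let within_step n x : {within `[0, T], continuous (step n x)}.
Proof. by apply: within_growth => y; exact: within_picard. Qed.

(** Induction through monotonicity of [growth]. Nonnegativity is carried along because [growth] is
    monotone only on nonnegative arguments. *)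
Lemma picard_mono n x t : 0 <= t <= T -> 0 <= picard n x t <= picard n.+1 x t.
Proof.
elim: n x t => [|n IH] x t t0T.
  rewrite lexx/= addr_ge0//; apply: Rintegral_ge0 => s _.
  by apply: growth_ge0.
have /andP[p0 pn] := IH x t t0T; have /andP[t0 tT] := t0T.
rewrite (le_trans p0 pn)/=.
rewrite lerD2l; apply: le_Rintegral => //.
- by apply: (integrable_initial (step n x)) => //; apply: within_integrable.
- by apply: (integrable_initial (step n.+1 x)) => //; apply: within_integrable.
- move=> s /=; rewrite in_itv/= => /andP[s0 st].
  by apply: growth_mono => // y; apply: IH; rewrite s0 (le_trans st).
Qed.

Hypotheses (Zc : {within `[0, T], continuous Z}).
Hypotheses (dZ : forall t, 0 < t < T -> derivable Z t 1).
Hypotheses (Z_ge0 : forall t, 0 <= t <= T -> 0 <= Z t).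
Hypotheses (phiZ : forall x, phi x <= Z 0).
Hypotheses (Z' : forall x t, 0 < t < T -> growth (k t) (fun=> Z t) x <= derive1 Z t).

(** The derivative of an iterate is [growth] at the previous one, hence at most [growth] at [Z],
    hence at most the derivative of [Z]; the initial values are ordered as well. *)
Lemma picard_le n x t : 0 <= t <= T -> picard n x t <= Z t.
Proof.
elim: n x t => [|n IH] x t t0T; first exact: Z_ge0.
have dpic s : 0 < s < T ->
    derivable (picard n.+1 x) s 1 /\ derive1 (picard n.+1 x) s = step n x s.
  exact: (derive_primitive (phi x) (step n x) s (within_step n x)).
apply: (derive1_le_monotone _ _ _ _ (within_picard n.+1 x) Zc _ dZ _ _ t t0T).
- by move=> s /dpic[].
- move=> s sT; have [_ ->] := dpic _ sT.
  apply: le_trans (Z' x _ sT); apply: growth_mono => // y.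
  have sT' : 0 <= s <= T by have /andP[/ltW-> /ltW->] := sT.
  by rewrite IH// andbT; have /andP[] := picard_mono n y _ sT'.
- by rewrite [picard _ _ 0]primitive0.
Qed.

Let v x t := limn (fun n => picard n x t).

Lemma picard_nd x t : 0 <= t <= T -> nondecreasing_seq (fun n => picard n x t).
Proof.
move=> t0T; apply/nondecreasing_seqP => n.
by have /andP[] := picard_mono n x _ t0T.
Qed.

Lemma picard_cvg x t : 0 <= t <= T -> picard n x t @[n --> \oo] --> v x t.
Proof.
move=> t0T; apply: nondecreasing_is_cvgn; first exact: picard_nd.
by exists (Z t) => _ [n _ <-]; exact: picard_le.
Qed.

Lemma limit_bounds x t : 0 <= t <= T -> 0 <= v x t <= Z t.
Proof.
move=> t0T; have cv := picard_cvg x _ t0T; apply/andP; split.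
  by have := nondecreasing_cvgn_le (picard_nd x _ t0T) cv 0%N.
by apply: limr_le => //; apply: nearW => n; exact: picard_le.
Qed.

Let field x s := growth (k s) (v ^~ s) x.

(** The integrands converge pointwise since [growth] is continuous, and [growth] evaluated at [Z] is
    an integrable majorant, so dominated convergence passes to the limit under the integral. *)
Lemma limit_integral_equation x :
  mu.-integrable `[0, T] (EFin \o field x) /\
  forall t, 0 <= t <= T -> v x t = primitive (phi x) (field x) t.
Proof.
have dct t : 0 <= t <= T -> mu.-integrable `[0, t] (EFin \o field x) /\
    (\int[mu]_(s in `[0%R, t]) (step n x s)%:E)%E @[n --> \oo] -->
    (\int[mu]_(s in `[0%R, t]) (field x s)%:E)%E.
  move=> /andP[t0 tT].
  have sub s : `[0, t]%classic s -> 0 <= s <= T.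
    by rewrite /= in_itv/= => /andP[-> /= /le_trans]; exact.
  have mstep n : measurable_fun `[0, t] (EFin \o step n x).
    have := integrable_initial _ _ tT (within_integrable _ (within_step n x)).
    by move=> /integrableP[].
  have stepc s : `[0, t]%classic s -> ((step n x s)%:E @[n --> \oo] --> (field x s)%:E)%E.
    move=> /sub sT; apply: cvg_EFin; first exact: nearW.
    by apply: growth_cvg => [|y]; [exact: cvg_cst|exact: picard_cvg].
  have mfield : measurable_fun `[0, t] (EFin \o field x).
    exact: (emeasurable_fun_cvg (fun n => EFin \o step n x)).
  pose g s := growth (k s) (fun=> Z s) x.
  have ig : mu.-integrable `[0, t] (EFin \o g).
    apply: integrable_initial => //; apply: within_integrable.
    exact: (within_growth (fun=> Z)).
  have bound n s : `[0, t]%classic s -> (`|(step n x s)%:E| <= (g s)%:E)%E.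
    move=> /sub sT /=; rewrite lee_fin ger0_norm.
      apply: growth_mono => // y; rewrite picard_le// andbT.
      by have /andP[] := picard_mono n y _ sT.
    by apply: growth_ge0 => // y; have /andP[] := picard_mono n y _ sT.
  have stepc_ae : {ae mu, forall s, `[0, t]%classic s ->
      (fun n => (step n x s)%:E) n @[n --> \oo] --> (field x s)%:E}.
    exact: aeW.
  have bound_ae : {ae mu, forall s n, `[0, t]%classic s ->
      (`|(step n x s)%:E| <= (g s)%:E)%E}.
    by apply: aeW => s n; exact: bound.
  have [ifield _ cvgi] := @dominated_convergence _ _ _ mu `[0, t] (measurable_itv _)
    (fun n => EFin \o step n x) (EFin \o field x) (EFin \o g) mstep mfield
    stepc_ae ig bound_ae.
  by split; [exact: ifield|exact: cvgi].
split; first by have [] := dct T; rewrite ?lexx ?ltW.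
move=> t t0T; have [ifi cvgi] := dct t t0T.
(* The integrals with index [n] give the iterate with index [n.+1]; the shift does not change the
   limit. *)
have : picard n.+1 x t @[n --> \oo] --> primitive (phi x) (field x) t.
  apply: cvgD; first exact: cvg_cst.
  apply: (@fine_cvg _ _ _ _ (fun n => \int[mu]_(s in `[0%R, t]) (step n x s)%:E)%E).
  by rewrite /Rintegral fineK//; exact: integrable_fin_num.
move=> /(cvg_lim (@Rhausdorff R)) <-; apply/esym/(cvg_lim (@Rhausdorff R)).
have := picard_cvg x _ t0T.
by rewrite -(cvg_shiftS (fun n => picard n x t)).
Qed.

(** A bootstrap: the limit is only known to be integrable after [growth] is applied, but the
    primitive is continuous. Since it agrees with the limit on [[0, T]], the integrand is continuous
    too, and the fundamental theorem of calculus gives the differential equation. *)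
Lemma cooperative_solution : exists u : V -> R -> R,
  [/\ forall x, {within `[0, T], continuous (u x)},
      forall x t, 0 <= t <= T -> 0 <= u x t <= Z t,
      forall x, u x 0 = phi x &
      forall x t, 0 < t < T -> derivable (u x) t 1 /\
        derive1 (u x) t = growth (k t) (u ^~ t) x].
Proof.
pose u x := primitive (phi x) (field x).
have uv x t : 0 <= t <= T -> u x t = v x t.
  by move=> t0T; have [_ ->] := limit_integral_equation x.
have uc x : {within `[0, T], continuous (u x)}.
  by apply: within_primitive; have [] := limit_integral_equation x.
have fieldE x t : 0 <= t <= T -> field x t = growth (k t) (u ^~ t) x.
  by move=> t0T; congr growth; apply/funext => y; rewrite uv.
have fieldc x : {within `[0, T], continuous (field x)}.
  have := within_growth u x uc; apply: subspace_eq_continuous => t.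
  by rewrite inE/= in_itv/= => tT; exact/esym/fieldE.
exists u; split => // [x t t0T|x|x t t0T].
- by rewrite uv// limit_bounds.
- exact: primitive0.
- have [du u'] := derive_primitive (phi x) (field x) t (fieldc x) t0T.
  split; [exact: du|rewrite u' fieldE//].
  by have /andP[/ltW-> /ltW->] := t0T.
Qed.

End CooperativeSystem.

Arguments growth {R V} p a k w x.

Lemma is_derive_expRM (R : realType) (D t l : R) (f : R -> R) :
  is_derive t 1 f l ->
  is_derive t 1 (fun s => expR (D * s) * f s) (expR (D * t) * (D * f t + l)).
Proof.
move=> df.
have dl : is_derive t 1 (fun s => D * s) D.
  by apply: is_derive_eq; rewrite /= [_%:A]mulr1.
have de := @is_derive1_comp _ expR (fun s => D * s) _ _ _ (is_derive_expR _) dl.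
have := @is_deriveM _ _ _ _ _ _ _ _ de df.
move=> /is_derive_eq; apply.
rewrite -[_ *: l]/(_ * l) -[_ *: (_ * D)]/(_ * (_ * D)) /=; ring.
Qed.

(** * The graph Laplacian and existence of solutions *)

Section WeightedGraph.
Variables (R : realType) (V : finType) (G : weighted_graph R V).

Definition wdegree (x : V) : R :=
  (vmeas G x)^-1 * \sum_(y | adj G x y) weight G x y.

Lemma vmeasV_ge0 x : 0 <= (vmeas G x)^-1.
Proof. by rewrite invr_ge0 ltW// vmeas_gt0. Qed.

Lemma wdegree_ge0 x : 0 <= wdegree x.
Proof.
apply: mulr_ge0; first exact: vmeasV_ge0.
by apply: sumr_ge0 => y _; exact: weight_ge0.
Qed.

Lemma laplacianE (f : V -> R) x : laplacian G f x =
  (vmeas G x)^-1 * (\sum_(y | adj G x y) weight G x y * f y) - wdegree x * f x.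
Proof.
rewrite /laplacian /wdegree -mulrA -mulrBr; congr (_ * _).
by rewrite mulr_suml -sumrB; apply: eq_bigr => y _; rewrite mulrBr.
Qed.

Lemma laplacian_ge (f : V -> R) x :
  (forall y, 0 <= f y) -> - (wdegree x * f x) <= laplacian G f x.
Proof.
move=> f0; rewrite laplacianE lerDr; apply: mulr_ge0; first exact: vmeasV_ge0.
by apply: sumr_ge0 => y _; rewrite mulr_ge0// weight_ge0.
Qed.

Lemma laplacian_min (f : V -> R) x :
  (forall y, f x <= f y) -> 0 <= laplacian G f x.
Proof.
move=> fx; apply: mulr_ge0; first exact: vmeasV_ge0.
by apply: sumr_ge0 => y _; rewrite mulr_ge0 ?weight_ge0// subr_ge0.
Qed.

Lemma laplacian_cst (c : R) x : laplacian G (fun=> c) x = 0.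
Proof. by rewrite /laplacian big1 ?mulr0// => y _; rewrite subrr mulr0. Qed.

Lemma laplacianZ (c : R) (f : V -> R) x :
  laplacian G (fun y => c * f y) x = c * laplacian G f x.
Proof.
rewrite /laplacian mulrCA; congr (_ * _); rewrite mulr_sumr.
by apply: eq_bigr => y _; rewrite -mulrBr mulrCA.
Qed.

(** The sum serves as one constant that is at least every weighted degree. *)
Definition total_wdegree : R := \sum_x wdegree x.

(** The matrix of the Laplacian plus [total_wdegree] times the identity; the shift makes the
    diagonal nonnegative. *)
Definition shifted_laplacian (x y : V) : R :=
  (if adj G x y then (vmeas G x)^-1 * weight G x y else 0) +
  (if y == x then total_wdegree - wdegree x else 0).

Lemma total_wdegree_ge0 : 0 <= total_wdegree.
Proof. by apply: sumr_ge0 => x _; exact: wdegree_ge0. Qed.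

Lemma shifted_laplacian_ge0 x y : 0 <= shifted_laplacian x y.
Proof.
apply: addr_ge0; case: ifP => // _.
  by rewrite mulr_ge0 ?weight_ge0 ?vmeasV_ge0.
rewrite subr_ge0 /total_wdegree (bigD1 x)//= lerDl.
by apply: sumr_ge0 => z _; exact: wdegree_ge0.
Qed.

Lemma shifted_laplacianE (f : V -> R) x :
  \sum_y shifted_laplacian x y * f y = laplacian G f x + total_wdegree * f x.
Proof.
rewrite laplacianE.
under eq_bigr do rewrite mulrDl.
rewrite big_split/= -addrA; congr (_ + _).
  rewrite mulr_sumr [RHS]big_mkcond/=; apply: eq_bigr => y _.
  by case: ifP => _; rewrite ?mul0r// mulrA.
rewrite (bigD1 x)//= eqxx big1 ?addr0; last first.
  by move=> y /negbTE ->; rewrite mul0r.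
by ring.
Qed.

Variables (p : R) (p1 : 1 < p).

Let D := total_wdegree.

Lemma solution_exists (phi : V -> R) (m T : R) :
  (forall x, 0 <= phi x <= m) -> 0 < m -> 0 < T ->
  T < (m `^ (p - 1))^-1 / (p - 1) ->
  exists u, is_solution G p phi T u.
Proof.
move=> phim m0 T0; set q := _^-1 => Tq.
have p10 : 0 < p - 1 by rewrite subr_gt0.
have p0 : 0 < p by rewrite (lt_trans ltr01).
have arg_gt0 t : t <= T -> 0 < q - (p - 1) * 1 * t.
  move=> tT; rewrite mulr1 subr_gt0 -ltr_pdivlMl// mulrC.
  exact: le_lt_trans tT Tq.
pose z := bernoulli p 1 q.
have z0 : z 0 = m.
  rewrite /z /bernoulli mulr0 subr0 /q -powRN powRN_powRV ?ltW//.
  by rewrite gt_eqF.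
have z_gt0 t : t <= T -> 0 < z t by move=> tT; exact/bernoulli_gt0/arg_gt0.
have dz t : t <= T -> is_derive t 1 z (1 * z t `^ p).
  by move=> tT; apply: is_derive_bernoulli => //; exact: arg_gt0.
(* The coefficient produced by v = e^(Dt) u: the reaction term e^(Dt) u^p equals e^((1-p)Dt) v^p. *)
pose k t := expR (D * t * (1 - p)).
pose Z t := expR (D * t) * z t.
have dZ t : t <= T -> is_derive t 1 Z (expR (D * t) * (D * z t + 1 * z t `^ p)).
  by move=> tT; exact/is_derive_expRM/dz.
have kc : continuous k.
  move=> t; apply: (@continuous_comp _ _ _ (fun t => D * t * (1 - p)) expR).
    by apply: cvgM; [apply: cvgM; [exact: cvg_cst|exact: cvg_id]|exact: cvg_cst].
  exact: continuous_expR.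
have Zc : {within `[0, T], continuous Z}.
  apply: derivable_within_continuous => t; rewrite in_itv/= => /andP[_ tT].
  exact: (@ex_derive _ _ _ _ _ _ _ (dZ _ tT)).
have kexp t w : 0 <= w -> k t * `|expR (D * t) * w| `^ p = expR (D * t) * w `^ p.
  move=> w0; rewrite ger0_norm ?mulr_ge0 ?expR_ge0// powRM ?expR_ge0//.
  rewrite mulrA; congr (_ * _); rewrite -expRM /k -expRD; congr expR; ring.
have phi_ge0 x : 0 <= phi x by have /andP[] := phim x.
have derZ t : 0 < t < T -> derivable Z t 1.
  by move=> /andP[_ /ltW tT]; exact: (@ex_derive _ _ _ _ _ _ _ (dZ t tT)).
have Z_ge0 t : 0 <= t <= T -> 0 <= Z t.
  by move=> /andP[_ tT]; rewrite mulr_ge0 ?expR_ge0// ltW// z_gt0.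
have phiZ x : phi x <= Z 0.
  by rewrite /Z mulr0 expR0 mul1r z0; have /andP[] := phim x.
(* The inequality is in fact an equality, because the Laplacian kills spatial constants. *)
have Zsuper x t : 0 < t < T ->
    growth p shifted_laplacian (k t) (fun=> Z t) x <= derive1 Z t.
  move=> /andP[_ /ltW tT].
  rewrite derive1E (@derive_val _ _ _ _ _ _ _ (dZ _ tT)) /growth.
  rewrite shifted_laplacianE laplacian_cst add0r (kexp _ _ (ltW (z_gt0 t tT))).
  by rewrite /Z -/D mul1r mulrDr mulrCA.
have [v [vc vb v0 v']] := cooperative_solution _ _ _ _ p1 shifted_laplacian_ge0
  _ _ _ _ T0 (continuous_subspaceT kc) (fun=> expR_ge0 _) phi_ge0 Zc derZ Z_ge0
  phiZ Zsuper.
pose u x t := expR (- D * t) * v x t.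
have vE x t : v x t = expR (D * t) * u x t.
  by rewrite /u mulrA -expRD mulNr subrr expR0 mul1r.
have u_ge0 x t : 0 <= t <= T -> 0 <= u x t.
  by move=> tT; rewrite mulr_ge0 ?expR_ge0//; have /andP[] := vb x t tT.
have ec : continuous (fun t => expR (- D * t)).
  move=> t; apply: (@continuous_comp _ _ _ (fun t => - D * t) expR).
    by apply: cvgM; [exact: cvg_cst|exact: cvg_id].
  exact: continuous_expR.
have uc x : {within `[0, T], continuous (u x)}.
  apply/subspace_continuousP => t tT; apply: cvgM.
    exact: cvg_within_filter (ec t).
  by move/subspace_continuousP : (vc x); exact.
have du x t : 0 < t < T -> is_derive t 1 (u x)
    (laplacian G (fun y => u y t) x + u x t `^ p).
  move=> tT; have [dv dv'] := v' x t tT.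
  have : is_derive t 1 (v x) (growth p shifted_laplacian (k t) (v ^~ t) x).
    by split => //; rewrite -derive1E.
  move=> /(is_derive_expRM _ (- D)) /is_derive_eq; apply.
  have tT' : 0 <= t <= T by have /andP[/ltW-> /ltW->] := tT.
  have -> : growth p shifted_laplacian (k t) (v ^~ t) x =
      laplacian G (v ^~ t) x + D * v x t + expR (D * t) * u x t `^ p.
    rewrite /growth shifted_laplacianE; congr (_ + _).
    by rewrite -(kexp _ _ (u_ge0 x t tT')) -vE.
  rewrite vE.
  have -> : laplacian G (v ^~ t) x = expR (D * t) * laplacian G (u ^~ t) x.
    by rewrite -laplacianZ; congr laplacian; apply/funext => y; rewrite vE.
  have e1 : expR (- D * t) * expR (D * t) = 1 by rewrite -expRD mulNr addNr expR0.
  rewrite -/D; transitivity (expR (- D * t) * expR (D * t) *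
    (laplacian G (u ^~ t) x + u x t `^ p)); first by ring.
  by rewrite e1 mul1r.
have [tM tMT ZM] := EVT_max (ltW T0) Zc.
exists u; split => [x t /andP[t0 /ltW tT]|x|x t tT|T' /andP[T'0 T'T]|].
- by rewrite u_ge0// t0.
- apply: continuous_subspaceW (uc x) => t /=; rewrite !in_itv/=.
  by move=> /andP[-> /ltW].
- split; first exact: (@ex_derive _ _ _ _ _ _ _ (du x t tT)).
  (* The right-hand side of the equation, written through [growth] so that its continuity follows
     from [growth_cvg]; the absolute value inside is harmless since [u] is nonnegative. *)
  pose F s := growth p shifted_laplacian 1 (u ^~ s) x - D * u x s.
  have uct y : {for t, continuous (u y)}.
    by apply: (within_continuous_continuous T0 (uc y)); rewrite in_itv.
  have Fc : F s @[s --> t] --> F t.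
    apply: cvgB; last by apply: cvgM; [exact: cvg_cst|exact: uct].
    by apply: growth_cvg => // ; exact: cvg_cst.
  have FE s : 0 < s < T -> derive1 (u x) s = F s.
    move=> sT; rewrite derive1E (@derive_val _ _ _ _ _ _ _ (du x s sT)) /F /growth.
    rewrite shifted_laplacianE mul1r ger0_norm -/D; first by ring.
    by have /andP[/ltW s0 /ltW s1] := sT; rewrite u_ge0// s0.
  suff : derive1 (u x) s @[s --> t] --> derive1 (u x) t by [].
  rewrite (FE t tT); apply: cvg_trans Fc; apply: near_eq_cvg.
  have tI : t \in `]0, T[ by rewrite in_itv.
  near=> s; apply/esym/FE.
  have : s \in `]0, T[ by near: s; exact: near_in_itvoo.
  by rewrite in_itv.
- exists (Z tM) => x t /andP[t0 tT'].
  have tT : t <= T by exact: le_trans tT' (ltW T'T).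
  have t0T : 0 <= t <= T by rewrite t0.
  rewrite ger0_norm ?u_ge0//.
  have /andP[v0' vZ] := vb x t t0T.
  apply: (@le_trans _ _ (v x t)); last first.
    by apply: le_trans vZ _; apply: ZM; rewrite in_itv.
  rewrite ler_piMl// -expR0 ler_expR mulNr oppr_le0 mulr_ge0//.
  exact: total_wdegree_ge0.
- split => [x t tT|x]; first by rewrite derive1E (@derive_val _ _ _ _ _ _ _ (du x t tT)).
  by rewrite /u mulr0 expR0 mul1r.
Unshelve. all: by end_near. Qed.

End WeightedGraph.

(** * Extrema over the vertex set *)

Section Extrema.
Variables (R : realType) (V : finType) (f : V -> R).

Lemma le_vmax x : f x <= vmax f.
Proof.
rewrite /vmax; case: pickP => [x0 _|/(_ x)//].
exact: (le_bigmax (f x0) f).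
Qed.

Lemma vmin_le x : vmin f <= f x.
Proof.
rewrite /vmin; case: pickP => [x0 _|/(_ x)//].
exact: (bigmin_le (f x0)).
Qed.

Lemma vmax_attained : V -> exists x, vmax f = f x.
Proof.
rewrite /vmax => y; case: pickP => [x0 _|/(_ y)//].
elim/big_ind: _ => [|a b [x ->] [z ->]|x _]; [by exists x0| |by exists x].
by rewrite maxEle; case: ifP; [exists z|exists x].
Qed.

End Extrema.

(** * Bounds on the life span *)

Section LifeSpanBounds.
Variables (R : realType) (V : finType) (G : weighted_graph R V) (p : R).
Hypothesis p1 : 1 < p.
Implicit Types (phi : V -> R) (m : R).

Lemma life_span_le phi (B : R) :
  (forall T u, 0 < T -> is_solution G p phi T u -> T <= B) ->
  (life_span G p phi <= B%:E)%E.
Proof.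
move=> H; apply: ge_ereal_sup => _ [T [T0 [u su]] <-].
by rewrite lee_fin; exact: H su.
Qed.

(** Only the function at [x] is followed, as a family indexed by [unit]; the nonnegative inflow from
    the neighbours is dropped. The smallness hypothesis says that at level [m] the reaction exceeds
    the loss: m^p > d m, with d the weighted degree. *)
Lemma life_span_le_vertex phi m x :
  (forall y, 0 <= phi y) -> 0 < m -> m <= phi x ->
  wdegree R V G x * (m `^ (p - 1))^-1 < 1 ->
  (life_span G p phi <=
    ((m `^ (p - 1))^-1 / ((p - 1) * (1 - wdegree R V G x * (m `^ (p - 1))^-1)))%:E)%E.
Proof.
move=> phi0 m0 mx dQ; apply: life_span_le => T u T0 [u0 uc du ub [u' ui]].
apply: (blowup_time _ _ tt (fun=> u x)) => // [|_ t tT|T' /ub[M uM]|_|_ t tT _].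
- exact: wdegree_ge0.
- by have [] := du x t tT.
- by exists M => t /(uM x); exact/le_trans/ler_norm.
- by rewrite ui.
- rewrite u'// addrC lerD2r.
  apply: (laplacian_ge R V G (u ^~ t)) => y; apply: u0.
  by have /andP[/ltW-> ->] := tT.
Qed.

(** All vertices are followed together. The differential inequality is needed only at a spatial
    minimum, where the Laplacian is nonnegative, so there is no loss term. *)
Lemma life_span_le_min phi m (x0 : V) :
  0 < m -> (forall x, m <= phi x) ->
  (life_span G p phi <= ((m `^ (p - 1))^-1 / (p - 1))%:E)%E.
Proof.
move=> m0 mphi; apply: life_span_le => T u T0 [u0 uc du ub [u' ui]].
have := blowup_time _ _ x0 u p 0 m T p1 (lexx 0) m0.
rewrite mul0r subr0 mulr1; apply => // [x t tT|T' /ub[M uM]|x|x t tT ux].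
- by have [] := du x t tT.
- by exists M => t /(uM x0); exact/le_trans/ler_norm.
- by rewrite ui.
- rewrite u'// mul0r subr0 lerDr.
  exact: (laplacian_min R V G (u ^~ t)).
Qed.

Lemma life_span_ge phi m :
  0 < m -> (forall x, 0 <= phi x <= m) ->
  (((m `^ (p - 1))^-1 / (p - 1))%:E <= life_span G p phi)%E.
Proof.
move=> m0 phim; set B := _ / _.
have B0 : 0 < B by rewrite divr_gt0 ?subr_gt0// invr_gt0 powR_gt0.
(* Existence is available only strictly before the bound [B], so it is approached from below;
   [B / 2] keeps [T] positive. *)
apply/lee_addgt0Pr => e e0; pose T := B - Num.min e (B / 2).
have TB : T < B by rewrite gtrBl lt_min e0/= divr_gt0.
have T0 : 0 < T.
  rewrite subr_gt0 gt_min; apply/orP; right.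
  by rewrite ltr_pdivrMr// ltr_pMr// ltr1n.
apply: (@le_trans _ _ (T%:E + e%:E)%E).
  by rewrite -EFinD lee_fin -lerBlDr lerB// ge_min lexx.
rewrite leeD2r//; apply: ereal_sup_ubound; exists T => //; split => //.
exact: (solution_exists R V G p p1 phi m T).
Qed.

End LifeSpanBounds.

(** * Lower and upper limits along a filter, and powers at infinity *)

Section Limits.
Variables (R : realType).

Lemma limf_einf_ge (F : set_system R) (f : R -> \bar R) (c : \bar R) :
  (\forall x \near F, (c <= f x)%E) -> (c <= limf_einf f F)%E.
Proof.
move=> Fc; rewrite limf_einfE; apply: le_ereal_sup_tmp.
exists (ereal_inf (f @` [set x | (c <= f x)%E])).
  by exists [set x | (c <= f x)%E].
by apply: le_ereal_inf_tmp => _ [x cx <-].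
Qed.

Lemma limf_esup_le (F : set_system R) (f : R -> \bar R) (c : \bar R) :
  (\forall x \near F, (f x <= c)%E) -> (limf_esup f F <= c)%E.
Proof.
move=> Fc; rewrite limf_esupE; apply: ge_ereal_inf.
exists (ereal_sup (f @` [set x | (f x <= c)%E])).
  by exists [set x | (f x <= c)%E].
by apply: ge_ereal_sup => _ [x cx <-].
Qed.

(** Two members of a proper filter share a point, and the value there lies between the infimum over
    one and the supremum over the other. *)
Lemma limf_einf_le_esup (F : set_system R) (f : R -> \bar R) :
  ProperFilter F -> (limf_einf f F <= limf_esup f F)%E.
Proof.
move=> FF; rewrite limf_einfE limf_esupE.
apply: ge_ereal_sup => _ [A FA <-]; apply: le_ereal_inf_tmp => _ [B FB <-].
have [x [Ax Bx]] := filter_ex (filterI FA FB).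
apply: (@le_trans _ _ (f x)).
  by apply: ereal_inf_lbound; exists x.
by apply: ereal_sup_ubound; exists x.
Qed.

Lemma cvg_powR_pinfty (s : R) : 0 < s -> x `^ s @[x --> +oo] --> +oo.
Proof.
move=> s0; apply/cvgryPge => A.
have B0 : 0 < Num.max A 1 by rewrite lt_max ltr01 orbT.
have BE : (Num.max A 1 `^ s^-1) `^ s = Num.max A 1.
  by rewrite -powRrM mulVf ?gt_eqF// powRr1// ltW.
apply: filterS (nbhs_pinfty_ge (num_real (Num.max A 1 `^ s^-1))) => x Bx.
apply: (@le_trans _ _ (Num.max A 1)); first by rewrite le_max lexx.
rewrite -BE; apply: ge0_ler_powR; rewrite ?nnegrE ?powR_ge0//; first exact: ltW.
by apply: le_trans Bx; exact: powR_ge0.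
Qed.

End Limits.

(** * Scaling of the bounds in the size of the initial datum *)

Theorem theorem1p4 (R : realType) (V : finType) (G : weighted_graph R V)
    (G_connected : connected_graph G)
    (p : R) (p_gt1 : 1 < p)
    (psi : V -> R) (psi_ge0 : forall x, 0 <= psi x)
    (psi_neq0 : exists x, psi x <> 0) :
  let T (lambda : R) : \bar R :=
    life_span G p (fun x => lambda * psi x) in
  let scaledT (lambda : R) : \bar R :=
    ((lambda `^ (p - 1))%:E * T lambda)%E in
  [/\ (exists Lambda : R, 0 < Lambda /\
         forall lambda : R, Lambda < lambda -> (T lambda < +oo)%E) /\
      scaledT lambda @[lambda --> +oo%R] -->
        (1 / ((p - 1) * vmax psi `^ (p - 1)))%:E,
      0 < vmin psi -> forall lambda : R, 0 < lambda -> (T lambda < +oo)%E &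
      0 < vmin psi ->
        [/\ ((1 / ((p - 1) * vmax psi `^ (p - 1)))%:E
               <= limf_einf scaledT 0^'+)%E,
            (limf_einf scaledT 0^'+ <= limf_esup scaledT 0^'+)%E &
            (limf_esup scaledT 0^'+
               <= (1 / ((p - 1) * vmin psi `^ (p - 1)))%:E)%E]].
Proof.
move=> T scaledT.
have p10 : 0 < p - 1 by rewrite subr_gt0.
have [y0 psi_y0] := psi_neq0.
have [x0 Mx0] := vmax_attained R V psi y0.
pose M := vmax psi; pose d := wdegree R V G x0.
have d0 : 0 <= d by exact: wdegree_ge0.
have M0 : 0 < M.
  apply: lt_le_trans (le_vmax R V psi y0).
  by rewrite lt_neqAle psi_ge0 andbT eq_sym; apply/eqP.
have scaleE (l m : R) : 0 < l -> 0 < m ->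
    l `^ (p - 1) * (((l * m) `^ (p - 1))^-1 / (p - 1)) = 1 / ((p - 1) * m `^ (p - 1)).
  move=> l0 m0; rewrite powRM ?ltW//; field.
  by rewrite !gt_eqF ?powR_gt0.
pose L := 1 / ((p - 1) * M `^ (p - 1)).
have L0 : 0 < L by rewrite divr_gt0// mulr_gt0// powR_gt0.
(* The scaled lower bound does not depend on [l], so it serves both at infinity and at 0. *)
have lower (l : R) : 0 < l -> (L%:E <= scaledT l)%E.
  move=> l0; rewrite /L -(scaleE l M l0 M0) EFinM lee_pmul2l//; last first.
    by rewrite lte_fin powR_gt0.
  apply: life_span_ge => //; first exact: mulr_gt0.
  by move=> x; rewrite mulr_ge0 ?(ltW l0)//= ler_pM2l// le_vmax.
pose Q (l : R) := ((l * M) `^ (p - 1))^-1.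
have Qcvg : Q l @[l --> +oo] --> 0.
  have lM : l * M @[l --> +oo] --> +oo by apply: gt0_cvgMly => //; exact: cvg_id.
  apply/(gtr0_cvgV0 (f := fun l => (l * M) `^ (p - 1))); last first.
    exact: cvg_comp _ _ lM (cvg_powR_pinfty _ _ p10).
  apply: filterS (nbhs_pinfty_gt (num_real 0)) => l l0.
  by rewrite powR_gt0// mulr_gt0.
have upper (l : R) : 0 < l -> d * Q l < 1 ->
    (T l <= (Q l / ((p - 1) * (1 - d * Q l)))%:E)%E.
  move=> l0 dQ; apply: life_span_le_vertex => //.
  - by move=> y; rewrite mulr_ge0// ltW.
  - exact: mulr_gt0.
  - by rewrite /M Mx0.
(* Beyond this value (l M)^(p-1) exceeds d + 1, hence d. Taking d + 1 keeps [Lambda] positive even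
   when the degree vanishes. *)
pose Lambda := (d + 1) `^ (p - 1)^-1 / M.
have d10 : 0 < d + 1 by rewrite ltr_wpDl.
have Lambda0 : 0 < Lambda by rewrite divr_gt0// powR_gt0.
have dQ1 (l : R) : Lambda < l -> d * Q l < 1.
  move=> ll; have l0 := lt_trans Lambda0 ll.
  rewrite ltr_pdivrMr ?powR_gt0 ?mulr_gt0// mul1r.
  have : d + 1 < (l * M) `^ (p - 1).
    have -> : d + 1 = ((d + 1) `^ (p - 1)^-1) `^ (p - 1).
      by rewrite -powRrM mulVf ?gt_eqF// powRr1// ltW.
    apply: gt0_ltr_powR => //; rewrite ?nnegrE ?powR_ge0//.
      by rewrite ltW// mulr_gt0.
    by rewrite -ltr_pdivrMr.
  by apply: lt_trans; rewrite ltrDl.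
have upper_min (l : R) : 0 < vmin psi -> 0 < l ->
    (T l <= (((l * vmin psi) `^ (p - 1))^-1 / (p - 1))%:E)%E.
  move=> m0 l0; apply: (life_span_le_min R V G p p_gt1 _ _ x0).
    exact: mulr_gt0.
  by move=> x; rewrite ler_pM2l// vmin_le.
split; [split|move=> m0 l l0|move=> m0].
- exists Lambda; split => // l ll.
  by apply: le_lt_trans (upper l (lt_trans Lambda0 ll) (dQ1 _ ll)) (ltry _).
(* The upper bound is [L] divided by a factor that tends to 1, because [Q l] tends to 0. *)
- apply: (@squeeze_cvge _ _ _ _ (fun=> L%:E) _ (fun l => (L / (1 - d * Q l))%:E)).
  + near=> l.
    have ll : Lambda < l by near: l; apply: nbhs_pinfty_gt; exact: num_real.
    have l0 := lt_trans Lambda0 ll.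
    rewrite lower//=.
    have -> : L / (1 - d * Q l) = l `^ (p - 1) * (Q l / ((p - 1) * (1 - d * Q l))).
      rewrite /L -(scaleE l M l0 M0) /Q invfM; ring.
    by rewrite EFinM lee_wpmul2l ?lee_fin ?powR_ge0//; exact: upper (dQ1 _ ll).
  + exact: cvg_cst.
  + apply: cvg_EFin; first exact: nearW.
    have den : 1 - d * Q l @[l --> +oo] --> (1 : R).
      have : 1 - d * Q l @[l --> +oo] --> 1 - d * 0.
        by apply: cvgB; [exact: cvg_cst|apply: cvgM => //; exact: cvg_cst].
      by rewrite mulr0 subr0.
    have : L / (1 - d * Q l) @[l --> +oo] --> L / 1.
      by apply: cvgM; [exact: cvg_cst|apply: cvgV => //; exact: oner_neq0].
    by rewrite divr1.
- exact: le_lt_trans (upper_min l m0 l0) (ltry _).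
- split.
  + apply: limf_einf_ge; near=> l; apply: lower.
    by near: l; exact: nbhs_right_gt.
  + exact: limf_einf_le_esup.
  + apply: limf_esup_le; near=> l.
    have l0 : 0 < l by near: l; exact: nbhs_right_gt.
    rewrite -(scaleE l (vmin psi) l0 m0) EFinM.
    by rewrite lee_wpmul2l ?lee_fin ?powR_ge0//; exact: upper_min.
Unshelve. all: by end_near. Qed.
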